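(* Let $\mathcal{A}$ be an abelian category with enough projectives and enough injectives, $(\mathcal{X},\mathcal{Y})$ a hereditary cotorsion pair in $\mathcal{A}$ and $n$ a positive integer. Then the following are equivalent: (a) $\mathcal{X}$ is an $n$-fold torsion-free class of $\mathcal{A}$; (b) $\mathcal{X}$ is a $\mathrm{K}^{(n-1)}\mathrm{E}$-closed subcategory of $\mathcal{A}$; (c) the resolution dimension of $\mathcal{A}$ with respect to $\mathcal{X}$ is at most $n$. Dually, the following are equivalent: (a)$^{\mathrm{op}}$ $\mathcal{Y}$ is an $n$-fold torsion class of $\mathcal{A}$; (b)$^{\mathrm{op}}$ $\mathcal{Y}$ is a $\mathrm{C}^{(n-1)}\mathrm{E}$-closed subcategory of $\mathcal{A}$; (c)$^{\mathrm{op}}$ the coresolution dimension of $\mathcal{A}$ with respect to $\mathcal{Y}$ is at most $n$.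
   Context: All subcategories are full and closed under isomorphisms. A cotorsion pair in $\mathcal{A}$ is a pair $(\mathcal{X},\mathcal{Y})$ of subcategories with $\mathcal{X}=\{M\mid\mathrm{Ext}^1_{\mathcal{A}}(M,Y)=0\ \forall Y\in\mathcal{Y}\}$ and $\mathcal{Y}=\{M\mid\mathrm{Ext}^1_{\mathcal{A}}(X,M)=0\ \forall X\in\mathcal{X}\}$; it is hereditary if $\mathrm{Ext}^{i}_{\mathcal{A}}(X,Y)=0$ for all $i>0$, $X\in\mathcal{X}$, $Y\in\mathcal{Y}$. Let $\mathcal{E}\subset\mathcal{A}$ be extension-closed. A conflation in $\mathcal{E}$ is a short exact sequence of $\mathcal{A}$ with all three terms in $\mathcal{E}$. A subcategory $\mathcal{S}\subset\mathcal{E}$ is a torsion-free class (resp. torsion class) of $\mathcal{E}$ if for every conflation $0\to A\to B\to C\to0$ in $\mathcal{E}$: $A,C\in\mathcal{S}$ implies $B\in\mathcal{S}$, and $B\in\mathcal{S}$ implies $A\in\mathcal{S}$ (resp. $C\in\mathcal{S}$). $\mathcal{S}$ is an $n$-fold torsion-free (resp. torsion) class of $\mathcal{A}$ if there are subcategories $\mathcal{F}_0=\mathcal{A},\mathcal{F}_1,\dots,\mathcal{F}_n=\mathcal{S}$ such that $\mathcal{F}_{i+1}$ is a torsion-free (resp. torsion) class of $\mathcal{F}_i$ for $0\le i\le n-1$. For $m\ge0$, a subcategory $\mathcal{S}$ of $\mathcal{A}$ is $\mathrm{K}^m\mathrm{E}$-closed if it is closed under extensions and under $m$-kernels: for every exact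 sequence $0\to M\to X^0\to X^1\to\cdots\to X^m$ in $\mathcal{A}$ with all $X^i\in\mathcal{S}$, one has $M\in\mathcal{S}$. Dually, $\mathcal{S}$ is $\mathrm{C}^m\mathrm{E}$-closed if it is closed under extensions and for every exact sequence $X_m\to\cdots\to X_0\to M\to0$ with all $X_i\in\mathcal{S}$, one has $M\in\mathcal{S}$. For $M\in\mathcal{A}$ the $\mathcal{X}$-resolution dimension of $M$ is the least $d\ge0$ such that there is an exact sequence $0\to X_d\to\cdots\to X_0\to M\to0$ with all $X_j\in\mathcal{X}$ (and $\infty$ if none exists; it is $0$ iff $M\in\mathcal{X}$); the resolution dimension of $\mathcal{A}$ with respect to $\mathcal{X}$ is the supremum of these over all $M\in\mathcal{A}$. The coresolution dimension with respect to $\mathcal{Y}$ is defined dually. *)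

(* Defs.v *)
From HB Require Import structures.
From mathcomp Require Import all_boot all_order all_algebra.
From mathcomp Require Import boolp.

Set Implicit Arguments.
Unset Strict Implicit.
Unset Printing Implicit Defensive.

Import GRing.Theory.
Local Open Scope ring_scope.

(** * Abelian categories *)

Record preadditive := Preadditive {
  Ob :> Type;
  Hom : Ob -> Ob -> zmodType;
  idm : forall a : Ob, Hom a a;
  comp : forall a b c : Ob, Hom b c -> Hom a b -> Hom a c;
  comp1m : forall (a b : Ob) (f : Hom a b), comp (idm b) f = f;
  compm1 : forall (a b : Ob) (f : Hom a b), comp f (idm a) = f;
  compA : forall (a b c d : Ob) (h : Hom c d) (g : Hom b c) (f : Hom a b),
    comp h (comp g f) = comp (comp h g) f;
  compDl : forall (a b c : Ob) (g g' : Hom b c) (f : Hom a b),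
    comp (g + g') f = comp g f + comp g' f;
  compDr : forall (a b c : Ob) (g : Hom b c) (f f' : Hom a b),
    comp g (f + f') = comp g f + comp g f'
}.

Arguments Hom {p} a b.
Arguments idm {p} a.
Arguments comp {p a b c} g f.

Notation "g \oc f" := (comp g f) (at level 40, left associativity).

Section Abelian.
Variable A : preadditive.
Implicit Types a b c : A.

Definition is_mono a b (f : Hom a b) :=
  forall x (u v : Hom x a), f \oc u = f \oc v -> u = v.

Definition is_epi a b (f : Hom a b) :=
  forall x (u v : Hom b x), u \oc f = v \oc f -> u = v.

Definition is_iso a b (f : Hom a b) :=
  exists g : Hom b a, g \oc f = idm a /\ f \oc g = idm b.

Definition is_kernel a b c (g : Hom b c) (k : Hom a b) :=
  g \oc k = 0 /\
  forall x (h : Hom x b), g \oc h = 0 -> exists! u : Hom x a, k \oc u = h.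

Definition is_cokernel a b c (f : Hom a b) (q : Hom b c) :=
  q \oc f = 0 /\
  forall x (h : Hom b x), h \oc f = 0 -> exists! u : Hom c x, u \oc q = h.

Definition is_zero_object (z : A) :=
  forall a, (forall f : Hom z a, f = 0) /\ (forall f : Hom a z, f = 0).

Definition has_biproduct a b :=
  exists (s : A) (i1 : Hom a s) (i2 : Hom b s) (p1 : Hom s a) (p2 : Hom s b),
    [/\ p1 \oc i1 = idm a, p2 \oc i2 = idm b, p1 \oc i2 = 0, p2 \oc i1 = 0
      & i1 \oc p1 + i2 \oc p2 = idm s].

Record abelian_category : Prop := AbelianCategory {
  ab_zero : exists z, is_zero_object z;
  ab_biproduct : forall a b, has_biproduct a b;
  ab_kernel : forall b c (g : Hom b c), exists a (k : Hom a b), is_kernel g k;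
  ab_cokernel : forall a b (f : Hom a b),
    exists c (q : Hom b c), is_cokernel f q;
  ab_normal : forall a b (f : Hom a b),
    is_mono f -> exists c (g : Hom b c), is_kernel g f;
  ab_conormal : forall b c (g : Hom b c),
    is_epi g -> exists a (f : Hom a b), is_cokernel f g
}.

(* The image of a morphism is the kernel of its cokernel. *)
Definition is_image a b x (f : Hom a b) (m : Hom x b) :=
  exists c (q : Hom b c), is_cokernel f q /\ is_kernel q m.

Definition exact a b c (f : Hom a b) (g : Hom b c) :=
  exists x (m : Hom x b), is_image f m /\ is_kernel g m.

Definition short_exact a b c (f : Hom a b) (g : Hom b c) :=
  [/\ is_mono f, exact f g & is_epi g].

Definition projective (p : A) :=
  forall b c (e : Hom b c) (f : Hom p c),
    is_epi e -> exists g : Hom p b, e \oc g = f.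

Definition injective_object (i : A) :=
  forall a b (m : Hom a b) (f : Hom a i),
    is_mono m -> exists g : Hom b i, g \oc m = f.

Definition enough_projectives :=
  forall a, exists p (e : Hom p a), projective p /\ is_epi e.

Definition enough_injectives :=
  forall a, exists i (m : Hom a i), injective_object i /\ is_mono m.

(** * Ext, as the cohomology of [Hom(P, b)] for projective resolutions [P] *)

Record proj_resolution a := ProjResolution {
  pr_ob : nat -> A;
  pr_d : forall i, Hom (pr_ob i.+1) (pr_ob i);
  pr_aug : Hom (pr_ob 0) a;
  pr_projective : forall i, projective (pr_ob i);
  pr_aug_epi : is_epi pr_aug;
  pr_exact0 : exact (pr_d 0) pr_aug;
  pr_exact : forall i, exact (pr_d i.+1) (pr_d i)
}.

Definition cocycle a (P : proj_resolution a) b i (f : Hom (pr_ob P i) b) :=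
  f \oc pr_d P i = 0.

Definition coboundary a (P : proj_resolution a) b i :
    Hom (pr_ob P i) b -> Prop :=
  match i with
  | 0 => fun f => f = 0
  | j.+1 => fun f => exists g : Hom (pr_ob P j) b, f = g \oc pr_d P j
  end.

(* [Ext^i(a, b) = 0]. Cohomology does not depend on the resolution, and
   resolutions exist when there are enough projectives, so that quantifying
   over all of them or fixing one amounts to the same. *)
Definition Ext_eq0 i a b :=
  forall (P : proj_resolution a) (f : Hom (pr_ob P i) b),
    cocycle f -> coboundary f.

(** * Subcategories *)

Record subcat := Subcat {
  in_sub :> A -> Prop;
  sub_iso : forall a b (f : Hom a b), is_iso f -> in_sub a -> in_sub b
}.

Implicit Types S E X Y : subcat.

Definition cotorsion_pair X Y :=
  (forall a, X a <-> forall y, Y y -> Ext_eq0 1 a y) /\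
  (forall a, Y a <-> forall x, X x -> Ext_eq0 1 x a).

Definition hereditary X Y :=
  forall (i : nat) x y, (0 < i)%N -> X x -> Y y -> Ext_eq0 i x y.

Definition extension_closed S :=
  forall a b c (f : Hom a b) (g : Hom b c),
    short_exact f g -> S a -> S c -> S b.

Definition conflation E a b c (f : Hom a b) (g : Hom b c) :=
  [/\ short_exact f g, E a, E b & E c].

Record torsion_free_class E S : Prop := TorsionFreeClass {
  tf_ambient : extension_closed E;
  tf_sub : forall a, S a -> E a;
  tf_ext : forall a b c (f : Hom a b) (g : Hom b c),
    conflation E f g -> S a -> S c -> S b;
  tf_left : forall a b c (f : Hom a b) (g : Hom b c),
    conflation E f g -> S b -> S a
}.

Record torsion_class E S : Prop := TorsionClass {
  tc_ambient : extension_closed E;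
  tc_sub : forall a, S a -> E a;
  tc_ext : forall a b c (f : Hom a b) (g : Hom b c),
    conflation E f g -> S a -> S c -> S b;
  tc_right : forall a b c (f : Hom a b) (g : Hom b c),
    conflation E f g -> S b -> S c
}.

Definition nfold_torsion_free_class (n : nat) S :=
  exists F : nat -> subcat,
    [/\ forall a, F 0%N a, forall a, F n a <-> S a
      & forall i, (i < n)%N -> torsion_free_class (F i) (F i.+1)].

Definition nfold_torsion_class (n : nat) S :=
  exists F : nat -> subcat,
    [/\ forall a, F 0%N a, forall a, F n a <-> S a
      & forall i, (i < n)%N -> torsion_class (F i) (F i.+1)].

(* Finite sequences are given by families indexed by all of [nat], of which
   only an initial part is constrained. The end term [M] is [C 0], and [C j.+1]
   is the term of index [j], written [X^j] or [X_j]. *)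

(* [0 -> M -> X^0 -> ... -> X^m] *)
Definition left_exact_sequence (m : nat) (C : nat -> A)
    (d : forall j, Hom (C j) (C j.+1)) :=
  is_mono (d 0%N) /\ forall j, (j < m)%N -> exact (d j) (d j.+1).

(* [X_m -> ... -> X_0 -> M -> 0] *)
Definition right_exact_sequence (m : nat) (C : nat -> A)
    (d : forall j, Hom (C j.+1) (C j)) :=
  is_epi (d 0%N) /\ forall j, (j < m)%N -> exact (d j.+1) (d j).

Definition kernels_closed (m : nat) S :=
  forall (C : nat -> A) (d : forall j, Hom (C j) (C j.+1)),
    left_exact_sequence m d -> (forall j, (j <= m)%N -> S (C j.+1)) ->
    S (C 0%N).

Definition cokernels_closed (m : nat) S :=
  forall (C : nat -> A) (d : forall j, Hom (C j.+1) (C j)),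
    right_exact_sequence m d -> (forall j, (j <= m)%N -> S (C j.+1)) ->
    S (C 0%N).

Definition KE_closed (m : nat) S := extension_closed S /\ kernels_closed m S.

Definition CE_closed (m : nat) S := extension_closed S /\ cokernels_closed m S.

(** * Resolution and coresolution dimensions *)

(* [0 -> X_l -> ... -> X_0 -> a -> 0] *)
Definition has_resolution X (a : A) (l : nat) :=
  exists (C : nat -> A) (d : forall j, Hom (C j.+1) (C j)),
    [/\ C 0%N = a, right_exact_sequence l d, is_mono (d l)
      & forall j, (j <= l)%N -> X (C j.+1)].

(* [0 -> a -> Y^0 -> ... -> Y^l -> 0] *)
Definition has_coresolution Y (a : A) (l : nat) :=
  exists (C : nat -> A) (d : forall j, Hom (C j) (C j.+1)),
    [/\ C 0%N = a, left_exact_sequence l d, is_epi (d l)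
      & forall j, (j <= l)%N -> Y (C j.+1)].

End Abelian.

(* Dimensions are extended natural numbers in [option nat], [None] being
   infinity. *)
Definition enat_le (x y : option nat) : bool :=
  match x, y with
  | _, None => true
  | None, Some _ => false
  | Some m, Some n => (m <= n)%N
  end.

(* The least natural number satisfying [P], infinity if there is none. *)
Definition enat_least (P : nat -> Prop) : option nat :=
  if pselect (exists n, `[< P n >]) is left exP then Some (ex_minn exP)
  else None.

(* The least upper bound of the family [x]. *)
Definition enat_sup (I : Type) (x : I -> option nat) : option nat :=
  enat_least (fun n => forall i, enat_le (x i) (Some n)).

Section Dimensions.
Variable A : preadditive.

Definition resdim (X : subcat A) (a : A) := enat_least (has_resolution X a).

Definition coresdim (Y : subcat A) (a : A) := enat_least (has_coresolution Y a).

Definition global_resdim (X : subcat A) := enat_sup (resdim X).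

Definition global_coresdim (Y : subcat A) := enat_sup (coresdim Y).

End Dimensions.

(* Main.v *)
(* For [j >= 0] let [Y_j] be the class of [j]-th cosyzygies of objects of [Y];
   as the pair is hereditary, [Y] contains [Y_1], which contains [Y_2], etc. Put
   [perp j] for the class of objects [M] with [Ext^1(M, Y_j) = 0], so that
   [perp 0 = X]. Dimension shifting gives, for a short exact sequence
   [0 -> A -> B -> C -> 0],
   - [A] in [perp j] when [B] is in [perp j] and [C] is in [perp j.+1];
   - [C] in [perp j.+1] when [A] is in [perp j] and [B] is in [perp j.+1].
   By the second fact [perp n] is everything when all [X]-resolution dimensions
   are at most [n]; by the first one [perp n], ..., [perp 0] is then a chain of
   torsion-free classes, and going down along the successive cokernels of an
   exact sequence [0 -> M -> X^0 -> ... -> X^(n-1)] one gets [M] in [X].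
   Conversely, either of the first two properties forces the [n]-th syzygies of
   all objects to lie in [X], which bounds the resolution dimensions. *)

Require Import Defs.
From mathcomp Require Import all_boot.
From mathcomp Require Import ssralg boolp.
Import Defs.

Set Implicit Arguments.
Unset Strict Implicit.
Unset Printing Implicit Defensive.

Import GRing.Theory.

(** * Bounds on dimensions valued in the extended natural numbers *)

Lemma enat_leastP (P : nat -> Prop) (n : nat) :
  enat_le (enat_least P) (Some n) <-> exists2 l, l <= n & P l.
Proof.
rewrite /enat_least; case: pselect => [exP|nexP] /=.
- case: ex_minnP => m /asboolP Pm min_m; split=> [le_mn|[l le_ln Pl]].
    by exists m.
  by apply: leq_trans le_ln; apply: min_m; apply/asboolP.
- split=> // -[l _ Pl]; case: nexP; exists l; exact/asboolP.
Qed.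

Lemma enat_supP (I : Type) (x : I -> option nat) (n : nat) :
  enat_le (enat_sup x) (Some n) <-> forall i, enat_le (x i) (Some n).
Proof.
rewrite enat_leastP; split=> [[l le_ln xl] i|xn]; last by exists n.
by have := xl i; case: (x i) => //= m le_ml; apply: leq_trans le_ln.
Qed.

Lemma global_resdimP (A : preadditive) (X : subcat A) (n : nat) :
  enat_le (global_resdim X) (Some n) <->
  forall a, exists2 l, l <= n & has_resolution X a l.
Proof.
by rewrite enat_supP; split=> X_n a; have /enat_leastP := X_n a.
Qed.

Lemma global_coresdimP (A : preadditive) (Y : subcat A) (n : nat) :
  enat_le (global_coresdim Y) (Some n) <->
  forall a, exists2 l, l <= n & has_coresolution Y a l.
Proof.
by rewrite enat_supP; split=> Y_n a; have /enat_leastP := Y_n a.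
Qed.

(** * The opposite category *)

(** Objects, morphisms and composition of [op A] reduce to those of [A], so a lemma applied to
    [op A] yields its dual by conversion. *)
Definition op (A : preadditive) : preadditive :=
  @Preadditive A (fun a b => @Hom A b a) (fun a => idm a)
    (fun a b c g f => f \oc g) (fun a b f => compm1 f) (fun a b f => comp1m f)
    (fun a b c d h g f => esym (compA f g h))
    (fun a b c g g' f => compDr f g g') (fun a b c g f f' => compDl f f' g).

(** * Monomorphisms, epimorphisms and kernels in preadditive categories *)

Section Preadditive.
Context {A : preadditive}.
Implicit Types a b c : A.
Local Open Scope ring_scope.

Lemma comp0m a b c (f : Hom a b) : (0 : Hom b c) \oc f = 0.
Proof. by apply: (addIr (0 \oc f)); rewrite -compDl !add0r. Qed.

Lemma compm0 a b c (f : Hom b c) : f \oc (0 : Hom a b) = 0.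
Proof. by apply: (addIr (f \oc 0)); rewrite -compDr !add0r. Qed.

Lemma compNl a b c (g : Hom b c) (f : Hom a b) : (- g) \oc f = - (g \oc f).
Proof. by apply: (addIr (g \oc f)); rewrite -compDl !addNr comp0m. Qed.

Lemma compNr a b c (g : Hom b c) (f : Hom a b) : g \oc (- f) = - (g \oc f).
Proof. by apply: (addIr (g \oc f)); rewrite -compDr !addNr compm0. Qed.

Lemma compBl a b c (g h : Hom b c) (f : Hom a b) :
  (g - h) \oc f = g \oc f - h \oc f.
Proof. by rewrite compDl compNl. Qed.

Lemma compBr a b c (g : Hom b c) (f h : Hom a b) :
  g \oc (f - h) = g \oc f - g \oc h.
Proof. by rewrite compDr compNr. Qed.

Lemma epi_of_eq0 a b (f : Hom a b) :
  (forall x (u : Hom b x), u \oc f = 0 -> u = 0) -> is_epi f.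
Proof.
move=> f0 x u v /eqP; rewrite -subr_eq0 -compBl => /eqP/f0/eqP.
by rewrite subr_eq0 => /eqP.
Qed.

Lemma epi_eq0 a b (f : Hom a b) x (u : Hom b x) :
  is_epi f -> u \oc f = 0 -> u = 0.
Proof. by move=> epi_f uf; apply: epi_f; rewrite uf comp0m. Qed.

Lemma mono_eq0 a b (f : Hom a b) x (u : Hom x a) :
  is_mono f -> f \oc u = 0 -> u = 0.
Proof. by move=> mono_f fu; apply: mono_f; rewrite fu compm0. Qed.

Lemma mono_comp {a b c} {g : Hom b c} {f : Hom a b} :
  is_mono g -> is_mono f -> is_mono (g \oc f).
Proof. by move=> g_m f_m x u v; rewrite -!compA => /g_m /f_m. Qed.

Lemma mono_of_comp {a b c} {g : Hom b c} {f : Hom a b} :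
  is_mono (g \oc f) -> is_mono f.
Proof. by move=> gf x u v e; apply: gf; rewrite -!compA e. Qed.

Lemma kernel_mono a b c (g : Hom b c) (k : Hom a b) : is_kernel g k -> is_mono k.
Proof.
move=> [gk kP] x u v e.
have [|w [_ uniq]] := kP x (k \oc u); first by rewrite compA gk comp0m.
by rewrite -(uniq u) // -(uniq v).
Qed.

Lemma kernel_lift {a b c} {g : Hom b c} {k : Hom a b} :
  is_kernel g k -> forall x (h : Hom x b), g \oc h = 0 -> exists u, k \oc u = h.
Proof. by move=> [_ kP] x h /kP [u [uP _]]; exists u. Qed.

Lemma mono_kernel a b c (g : Hom b c) (k : Hom a b) :
  is_mono k -> g \oc k = 0 ->
  (forall x (h : Hom x b), g \oc h = 0 -> exists u, k \oc u = h) ->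
  is_kernel g k.
Proof.
move=> k_m gk kP; split=> // x h /kP [u uP]; exists u; split=> // v vP.
by apply: k_m; rewrite uP vP.
Qed.

End Preadditive.

Arguments kernel_lift {A a b c g k} _ {x} h _.

Lemma cokernel_epi (A : preadditive) (a b c : A) (f : Hom a b) (q : Hom b c) :
  is_cokernel f q -> is_epi q.
Proof. exact: (@kernel_mono (op A)). Qed.

Lemma cokernel_desc (A : preadditive) (a b c : A) (f : Hom a b) (q : Hom b c) :
  is_cokernel f q ->
  forall x (h : Hom b x), (h \oc f = 0)%R -> exists u, u \oc q = h.
Proof. exact: (@kernel_lift (op A)). Qed.
Arguments cokernel_desc {A a b c f q} _ {x} h _.

Lemma epi_cokernel (A : preadditive) (a b c : A) (f : Hom a b) (q : Hom b c) :
  is_epi q -> (q \oc f = 0)%R ->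
  (forall x (h : Hom b x), (h \oc f = 0)%R -> exists u, u \oc q = h) ->
  is_cokernel f q.
Proof. exact: (@mono_kernel (op A)). Qed.

Lemma abelian_op (A : preadditive) : abelian_category A -> abelian_category (op A).
Proof.
move=> [z bi ker coker nor conor]; split.
- by have [z0 z0P] := z; exists z0 => a; have [] := z0P a.
- move=> a b; have [s [i1 [i2 [p1 [p2 [e1 e2 e3 e4 e5]]]]]] := bi a b.
  by exists s, p1, p2, i1, i2; split.
- by move=> b c g; apply: coker.
- by move=> a b f; apply: ker.
- by move=> a b f; apply: conor.
- by move=> b c g; apply: nor.
Qed.

(** * Exactness *)

(** By conormality [g] is the cokernel of some [h], and [h] factors through [f]; so whatever kills
    [f] kills [h] and descends along [g]. *)
Lemma kernel_cokernel {A : preadditive} (abA : abelian_category A)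
    {a b c : A} {f : Hom a b} {g : Hom b c} :
  is_epi g -> is_kernel g f -> is_cokernel f g.
Proof.
move=> g_epi gf; have [d [h hg]] := ab_conormal abA g_epi.
apply: epi_cokernel => //; first by case: gf.
move=> x w wf; apply: (cokernel_desc hg).
have [|u <-] := kernel_lift gf h; first by case: hg.
by rewrite compA wf comp0m.
Qed.

Lemma cokernel_kernel {A : preadditive} (abA : abelian_category A)
    {a b c : A} {f : Hom a b} {g : Hom b c} :
  is_mono f -> is_cokernel f g -> is_kernel g f.
Proof. exact: (@kernel_cokernel (op A) (abelian_op abA)). Qed.

Section Exactness.
Context {A : preadditive} (abA : abelian_category A).
Implicit Types a b c : A.
Local Open Scope ring_scope.

Lemma exact_op a b c (f : Hom a b) (g : Hom b c) :
  exact f g -> @exact (op A) c b a g f.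
Proof.
move=> [x [m [[y [q [fq qm]]] gm]]].
exists y, q; split=> //; exists x, m; split=> //.
by apply: (kernel_cokernel abA) => //; apply: cokernel_epi fq.
Qed.

Lemma mono_epi_iso a b (f : Hom a b) : is_mono f -> is_epi f -> is_iso f.
Proof.
move=> f_m f_e; have [c [g gf]] := ab_normal abA f_m.
have g0 : g = 0 by apply: epi_eq0 f_e _; case: gf.
have [|h fh] := kernel_lift gf (idm b); first by rewrite g0 comp0m.
by exists h; split=> //; apply: f_m; rewrite compA fh comp1m compm1.
Qed.

Lemma exactP a b c (f : Hom a b) (g : Hom b c) :
  exact f g <-> exists x (e : Hom a x) (m : Hom x b),
    [/\ f = m \oc e, is_epi e & is_kernel g m].
Proof.
split=> [[x [m [[y [q [fq qm]]] gm]]]|[x [e [m [-> e_epi gm]]]]].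
- have [|e fE] := kernel_lift qm f; first by case: fq.
  (* If [u \oc e = 0], then [f] factors through [m \oc i], with [i] the kernel of [u]. This mono is
     the kernel of some [w], which kills [f], so descends along [q] and kills [m]. Hence [i] has a
     section and [u = 0]. *)
  exists x, e, m; split=> //; apply: epi_of_eq0 => t u ue.
  have [k [i ui]] := ab_kernel abA u.
  have [e' eE] := kernel_lift ui _ ue.
  have [z [w wmi]] := ab_normal abA (mono_comp (kernel_mono qm) (kernel_mono ui)).
  have [w' wE] : exists w', w' \oc q = w.
    apply: (cokernel_desc fq); rewrite -fE -eE !compA -(compA w m).
    by case: wmi => -> _; rewrite comp0m.
  have [|s ms] := kernel_lift wmi m.
    by rewrite -wE -compA; case: qm => -> _; rewrite compm0.
  have /(kernel_mono qm) is1 : m \oc (i \oc s) = m \oc idm x.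
    by rewrite compA ms compm1.
  by rewrite -(compm1 u) -is1 compA; case: ui => -> _; rewrite comp0m.
- have m_m := kernel_mono gm; have [y [q mq]] := ab_cokernel abA m.
  exists x, m; split=> //; exists y, q; split; last exact: cokernel_kernel mq.
  case: (mq) => qm _; apply: epi_cokernel.
  + exact: cokernel_epi mq.
  + by rewrite compA qm comp0m.
  + move=> t h hme; apply: (cokernel_desc mq).
    by apply: epi_eq0 e_epi _; rewrite -compA.
Qed.

Lemma exact_mono_compl a b c d (f : Hom a b) (g : Hom b c) (m : Hom c d) :
  is_mono m -> exact f (m \oc g) <-> exact f g.
Proof.
move=> m_m; rewrite !exactP.
split=> -[x [e [k [fE e_epi kP]]]]; exists x, e, k; split=> //;
  have k_m := kernel_mono kP; apply: mono_kernel => //.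
- by apply: mono_eq0 m_m _; rewrite compA; case: kP.
- by move=> t h gh; apply: (kernel_lift kP); rewrite -compA gh compm0.
- by rewrite -compA; case: kP => -> _; rewrite compm0.
- move=> t h mgh; apply: (kernel_lift kP).
  by apply: mono_eq0 m_m _; rewrite compA.
Qed.

Lemma short_exactP a b c (f : Hom a b) (g : Hom b c) :
  short_exact f g <-> is_kernel g f /\ is_epi g.
Proof.
split=> [[f_m fg g_e]|[gf g_e]].
- split=> //; case: fg => x [m [[y [q [fq qm]]] gm]].
  have qf := cokernel_kernel abA f_m fq.
  have [|u fE] := kernel_lift qm f; first by case: fq.
  apply: mono_kernel => //.
    by rewrite -fE compA; case: gm => -> _; rewrite comp0m.
  move=> t h /(kernel_lift gm) [v <-]; apply: (kernel_lift qf).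
  by rewrite compA; case: qm => -> _; rewrite comp0m.
- split=> //; first exact: kernel_mono gf.
  apply/exactP; exists a, (idm a), f; split=> //; first by rewrite compm1.
  by move=> x u v; rewrite !compm1.
Qed.

Lemma epi_short_exact b c (g : Hom b c) :
  is_epi g -> exists a (f : Hom a b), short_exact f g.
Proof.
move=> g_e; have [a [f gf]] := ab_kernel abA g.
by exists a, f; apply/short_exactP.
Qed.

Lemma short_exact_op a b c (f : Hom a b) (g : Hom b c) :
  short_exact f g -> @short_exact (op A) c b a g f.
Proof. by move=> [f_m fg g_e]; split=> //; apply: exact_op. Qed.

Lemma short_exact_splice a b c d (e : Hom a b) (f : Hom b c) (g : Hom c d) :
  is_epi e -> short_exact f g -> exact (f \oc e) g.
Proof. by move=> e_epi /short_exactP[gf _]; apply/exactP; exists b, e, f. Qed.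

End Exactness.

Lemma exact_opE {A : preadditive} (abA : abelian_category A)
    {a b c : A} (f : Hom a b) (g : Hom b c) :
  @exact (op A) c b a g f <-> exact f g.
Proof.
split; last exact: exact_op.
exact: (@exact_op (op A) (abelian_op abA)).
Qed.

Lemma short_exact_opE {A : preadditive} (abA : abelian_category A)
    {a b c : A} (f : Hom a b) (g : Hom b c) :
  @short_exact (op A) c b a g f <-> short_exact f g.
Proof.
split; last exact: short_exact_op.
exact: (@short_exact_op (op A) (abelian_op abA)).
Qed.

Lemma mono_short_exact {A : preadditive} (abA : abelian_category A)
    {a b : A} (f : Hom a b) :
  is_mono f -> exists c (g : Hom b c), short_exact f g.
Proof.
move=> f_m; have [c [g gf]] := @epi_short_exact _ (abelian_op abA) b a f f_m.
by exists c, g; apply/short_exact_opE.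
Qed.

(** * Vanishing of the first extension group *)

(* Splitting is self-dual, unlike the definition of [Ext_eq0] by projective
   resolutions; this is what lets the second equivalence be deduced from the
   first one in the opposite category. *)
Definition ext1_zero {A : preadditive} (a b : A) :=
  forall v (f : Hom b v) (g : Hom v a), short_exact f g ->
  exists s, g \oc s = idm a.

Section Ext1.
Context {A : preadditive} (abA : abelian_category A).
Implicit Types a b c : A.
Local Open Scope ring_scope.

Lemma split_retract a b c (f : Hom a b) (g : Hom b c) (s : Hom c b) :
  short_exact f g -> g \oc s = idm c -> exists r : Hom b a, r \oc f = idm a.
Proof.
move=> /(short_exactP abA) [gf g_e] gs.
have [|r rE] := kernel_lift gf (idm b - s \oc g).
  by rewrite compBr compA gs comp1m compm1 subrr.
exists r; apply: (kernel_mono gf); rewrite compA rE compBl comp1m compm1 -compA.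
by case: gf => -> _; rewrite compm0 subr0.
Qed.

Lemma ext1_zero_op a b : ext1_zero a b -> @ext1_zero (op A) b a.
Proof.
move=> ab v f g /(short_exact_opE abA) gf; have [s sP] := ab _ _ _ gf.
exact: split_retract gf sP.
Qed.

(* The lift is a section of the pullback of [g] along [h]. *)
Lemma ext1_lift a b v c (f : Hom b v) (g : Hom v c) (h : Hom a c) :
  ext1_zero a b -> short_exact f g -> exists t, g \oc t = h.
Proof.
move=> ab /(short_exactP abA) [gf g_e].
have [s [i1 [i2 [p1 [p2 [e11 e22 e12 e21 es]]]]]] := ab_biproduct abA v a.
(* The kernel [k] of [d] is the pullback of [g] and [h], with projections [p1 \oc k] and
   [p2 \oc k]. *)
set d := g \oc p1 - h \oc p2.
have di1 : d \oc i1 = g by rewrite compBl -!compA e11 e21 compm1 compm0 subr0.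
have di2 : d \oc i2 = - h.
  by rewrite compBl -!compA e12 e22 compm1 compm0 sub0r.
have d_e : is_epi d.
  by apply: epi_of_eq0 => x u ud; apply: epi_eq0 g_e _; rewrite -di1 compA ud comp0m.
have [w [k dk]] := ab_kernel abA d.
have kd := kernel_cokernel abA d_e dk.
have gp : g \oc (p1 \oc k) = h \oc (p2 \oc k).
  by apply/eqP; rewrite -subr_eq0 !compA -compBl; case: dk => -> _.
(* Pullback preserves the epimorphism [g]: if [u] kills [p2 \oc k], then [u \oc p2 = t \oc d] for
   some [t], and composing with [i1] gives [t \oc g = 0]. *)
have q_e : is_epi (p2 \oc k).
  apply: epi_of_eq0 => x u; rewrite compA => /(cokernel_desc kd) [t tE].
  have t0 : t = 0.
    by apply: epi_eq0 g_e _; rewrite -di1 compA tE -compA e21 compm0.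
  by rewrite -(compm1 u) -e22 compA -tE t0 comp0m comp0m.
have [|j kj] := kernel_lift dk (i1 \oc f).
  by rewrite compA di1; case: gf.
have [|r rP] := ab w j (p2 \oc k).
  apply/(short_exactP abA); split=> //; apply: mono_kernel.
  - apply: (@mono_of_comp _ _ _ _ (p1 \oc k)).
    by rewrite -compA kj compA e11 comp1m; apply: kernel_mono gf.
  - by rewrite -compA kj compA e21 comp0m.
  - move=> x u; rewrite -compA => p2ku.
    have [|t tE] := kernel_lift gf (p1 \oc k \oc u).
      by rewrite compA gp -!compA p2ku compm0.
    exists t; apply: (kernel_mono dk); rewrite compA kj -[RHS]comp1m -es compDl.
    by rewrite -(compA i2) p2ku compm0 addr0 -[LHS]compA tE !compA.
by exists (p1 \oc k \oc r); rewrite compA gp -compA rP compm1.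
Qed.

(** This stands in for the long exact sequence of Ext. In an extension [v] of [a] by [b], lift [g]
    to [l : p -> v]; on [k] it lands in [b], and subtracting an extension of that map to [p] leaves
    a morphism that descends to a section. *)
Lemma ext1_of_presentation k p a b (f : Hom k p) (g : Hom p a) :
  short_exact f g -> ext1_zero p b ->
  (forall h : Hom k b, exists t, t \oc f = h) -> ext1_zero a b.
Proof.
move=> fg pb ext v i q iq; have [l lE] := ext1_lift g pb iq.
have /(short_exactP abA) [qi q_e] := iq.
have /(short_exactP abA) [gf g_e] := fg.
have [|h hE] := kernel_lift qi (l \oc f).
  by rewrite compA lE; case: gf.
have [t tE] := ext h.
have [|s sE] := cokernel_desc (kernel_cokernel abA g_e gf) (l - i \oc t).
  by rewrite compBl -compA tE hE subrr.
exists s; apply: g_e; rewrite -compA sE compBr compA lE comp1m.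
by case: qi => -> _; rewrite comp0m subr0.
Qed.

Lemma projective_ext1 p b : projective p -> ext1_zero p b.
Proof. by move=> p_proj v f g [_ _ g_e]; apply: p_proj. Qed.

Lemma ext1_iso a a' b (f : Hom a a') :
  is_iso f -> ext1_zero a b -> ext1_zero a' b.
Proof.
move=> [g [_ fg]] ab v i q iq; have [l lE] := ext1_lift f ab iq.
by exists (l \oc g); rewrite compA lE.
Qed.

End Ext1.

Section Ext1Dual.
Context {A : preadditive} (abA : abelian_category A).
Let abO := abelian_op abA.
Implicit Types a b c : A.

Lemma ext1_zero_opE a b : @ext1_zero (op A) b a <-> ext1_zero a b.
Proof. by split; [exact: (ext1_zero_op abO)|exact: ext1_zero_op]. Qed.

Lemma ext1_extend a b u v (f : Hom u v) (g : Hom v a) (h : Hom u b) :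
  ext1_zero a b -> short_exact f g -> exists t, t \oc f = h.
Proof.
move=> /ext1_zero_opE ab /(short_exact_opE abA) fg.
exact: (ext1_lift abO h ab fg).
Qed.

Lemma injective_ext1 a i : injective_object i -> ext1_zero a i.
Proof. by move=> i_inj; apply/ext1_zero_opE/projective_ext1 => b c e f; apply: i_inj. Qed.

Lemma ext1_of_copresentation a b i z (f : Hom b i) (g : Hom i z) :
  short_exact f g -> ext1_zero a i ->
  (forall h : Hom a z, exists t, g \oc t = h) -> ext1_zero a b.
Proof.
move=> /(short_exact_opE abA) fg /ext1_zero_opE ai lft; apply/ext1_zero_opE.
exact: (ext1_of_presentation abO fg ai lft).
Qed.

(** With [z] embedded in an injective [i] with cokernel [w], a map from [b] to [w] is lifted to [i]
    in two stages: its restriction to [a] lifts and extends to [b] by injectivity, then the error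
    descends to [c] and lifts from there. *)
Lemma ext1_extension a b c z (f : Hom a b) (g : Hom b c) :
  enough_injectives A -> short_exact f g ->
  ext1_zero a z -> ext1_zero c z -> ext1_zero b z.
Proof.
move=> injA fg az cz; have [i [m [i_inj m_m]]] := injA z.
have [w [q mq]] := mono_short_exact abA m_m.
have /(short_exactP abA) [gf g_e] := fg.
apply: (ext1_of_copresentation mq) => [|h]; first exact: injective_ext1.
have [t1 t1E] := ext1_lift abA (h \oc f) az mq.
have [|t2 t2E] := i_inj _ _ f t1; first by case: fg.
have [|h' h'E] := cokernel_desc (kernel_cokernel abA g_e gf) (h - q \oc t2)%R.
  by rewrite compBl -compA t2E t1E subrr.
have [t3 t3E] := ext1_lift abA h' cz mq.
by exists (t2 + t3 \oc g)%R; rewrite compDr compA t3E h'E addrC subrK.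
Qed.

End Ext1Dual.

(** * Projective resolutions *)

Section Resolutions.
Context {A : preadditive} (abA : abelian_category A).
Context (projA : enough_projectives A).
Implicit Types a b c k p : A.

Lemma exists_presentation a : exists k p (f : Hom k p) (g : Hom p a),
  projective p /\ short_exact f g.
Proof.
have [p [g [p_proj g_e]]] := projA a.
by have [k [f fg]] := epi_short_exact abA g_e; exists k, p, f, g.
Qed.

Lemma exists_proj_resolution a : inhabited (proj_resolution a).
Proof.
have pres b : exists t : {k : A & {p : A & (Hom k p * Hom p b)%type}},
    projective (projT1 (projT2 t)) /\
    short_exact (projT2 (projT2 t)).1 (projT2 (projT2 t)).2.
  have [k [p [f [g [p_proj fg]]]]] := exists_presentation b.
  by exists (existT _ k (existT _ p (f, g))).
pose T b := projT1 (cid (pres b)); have TP b := projT2 (cid (pres b)).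
pose ker b := projT1 (T b); pose cov b := projT1 (projT2 (T b)).
pose inc b : Hom (ker b) (cov b) := (projT2 (projT2 (T b))).1.
pose prj b : Hom (cov b) b := (projT2 (projT2 (T b))).2.
have se b : short_exact (inc b) (prj b) by case: (TP b).
have prj_e b : is_epi (prj b) by case: (se b).
(* [syz i.+1] computes to [ker (syz i)], so the differential can be the cover of [syz i.+1] followed
   by its inclusion into the cover of [syz i]. *)
pose syz i := iter i ker a.
pose d i : Hom (cov (syz i.+1)) (cov (syz i)) := inc (syz i) \oc prj (syz i.+1).
constructor; apply: (@ProjResolution _ a (fun i => cov (syz i)) d (prj a)).
- by move=> i; case: (TP (syz i)).
- exact: prj_e.
- exact: short_exact_splice.
- move=> i; apply/exact_mono_compl => //; first by case: (se (syz i)).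
  exact: short_exact_splice.
Qed.

(** Transparent, because in positive degrees the terms must reduce to those of [R]: this makes the
    dimension shift in [Ext_eq0_syzygy] a conversion. *)
Definition pr_cons k p a (f : Hom k p) (g : Hom p a) (p_proj : projective p)
    (fg : short_exact f g) (R : proj_resolution k) : proj_resolution a.
Proof.
pose ob i := if i is j.+1 then pr_ob R j else p.
pose d i : Hom (ob i.+1) (ob i) :=
  match i return Hom (ob i.+1) (ob i) with
  | 0 => f \oc pr_aug R
  | j.+1 => pr_d R j
  end.
apply: (@ProjResolution _ a ob d g).
- by case=> [|i] //; apply: pr_projective.
- by case: fg.
- by apply: short_exact_splice => //; apply: pr_aug_epi.
- case=> [|i] /=; last exact: pr_exact.
  by apply/exact_mono_compl; [|case: fg|apply: pr_exact0].
Defined.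

Lemma Ext_eq0_syzygy i k p a b (f : Hom k p) (g : Hom p a) :
  projective p -> short_exact f g -> Ext_eq0 i.+2 a b -> Ext_eq0 i.+1 k b.
Proof.
by move=> p_proj fg ab R h hR; apply: (ab (pr_cons p_proj fg R) h hR).
Qed.

(** Cocycles of degree 1 are maps out of the first syzygy, and coboundaries are those that extend to
    the projective in degree 0. One resolution extending a presentation gives the splittings;
    conversely an arbitrary resolution has to be treated. *)
Lemma Ext1P a b : Ext_eq0 1 a b <-> ext1_zero a b.
Proof.
split=> [ab|ab P h hP].
- have [k [p [f [g [p_proj fg]]]]] := exists_presentation a.
  have [R] := exists_proj_resolution k.
  apply: (ext1_of_presentation abA fg) => [|h]; first exact: projective_ext1.
  case: (ab (pr_cons p_proj fg R) (h \oc pr_aug R)).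
    rewrite /cocycle /= -compA.
    have /(exactP abA) [x [e [m [-> _ [mR _]]]]] := pr_exact0 R.
    by rewrite (compA _ m) mR comp0m compm0.
  move=> t /= tE; exists t; apply: (@pr_aug_epi _ _ R).
  by rewrite -compA tE.
- have /(exactP abA) [x [e [m [dE e_epi mP]]]] := pr_exact0 P.
  (* [e] is the cokernel of [pr_d P 1], so the cocycle [h] descends to the syzygy [x]. *)
  have [|h' h'E] := cokernel_desc (f := pr_d P 1) (q := e) _ h hP.
    have := exact_op abA (pr_exact P 0); rewrite dE => de.
    have /(exactP abA) [y [e' [m' [d1E e'_epi m'e]]]] : exact (pr_d P 1) e.
      apply/(exact_mono_compl abA _ _ (kernel_mono mP)).
      by rewrite -dE; apply: pr_exact.
    have [em' _] := kernel_cokernel abA e_epi m'e.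
    apply: epi_cokernel => //; first by rewrite d1E compA em' comp0m.
    move=> t u; rewrite d1E compA => /epi_eq0 um'.
    exact: (cokernel_desc (kernel_cokernel abA e_epi m'e) u (um' e'_epi)).
  have [|t tE] := ext1_extend abA (f := m) (g := pr_aug P) h' ab.
    by apply/(short_exactP abA); split=> //; apply: pr_aug_epi.
  by exists t; rewrite dE compA tE h'E.
Qed.

End Resolutions.

(** * Splicing exact sequences *)

Section Splicing.
Context {A : preadditive} (abA : abelian_category A).
Implicit Types (a k p : A) (S : A -> Prop).

(* [Q] is a condition on the leftmost morphism: [is_mono] for resolutions, no
   condition for the sequences of [cokernels_closed]. *)
Definition spliceable (Q : forall a b : A, Hom a b -> Prop) :=
  forall a b c (m : Hom b c) (f : Hom a b), is_mono m -> Q a c (m \oc f) <-> Q a b f.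

(** With [is_mono] this unfolds to [has_resolution]; with the trivial condition in [op A] it
    captures the sequences of [kernels_closed]. *)
Definition resolved (Q : forall a b : A, Hom a b -> Prop) S a (l : nat) :=
  exists (C : nat -> A) (d : forall j, Hom (C j.+1) (C j)),
    [/\ C 0 = a, right_exact_sequence l d, Q (C l.+1) (C l) (d l)
      & forall j, j <= l -> S (C j.+1)].

Lemma spliceable_mono : spliceable (@is_mono A).
Proof.
by move=> a b c m f m_m; split=> [/mono_of_comp|]//; apply: mono_comp.
Qed.

Lemma resolved_cons Q S k p a l (f : Hom k p) (g : Hom p a) :
  spliceable Q -> short_exact f g -> S p -> resolved Q S k l -> resolved Q S a l.+1.
Proof.
move=> Qs fg Sp [C [d [C0 [d0_e d_ex] Qd SC]]]; case: _ / C0 in f fg *.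
pose C' j := match j with 0 => a | 1 => p | i.+2 => C i.+1 end.
pose d' j : Hom (C' j.+1) (C' j) :=
  match j return Hom (C' j.+1) (C' j) with
  | 0 => g
  | 1 => f \oc d 0
  | i.+2 => d i.+1
  end.
have f_m : is_mono f by case: fg.
exists C', d'; split=> //.
- split; first by case: fg.
  case=> [|[|j]] lt_jl; first exact: short_exact_splice.
  + by apply/exact_mono_compl => //; apply: d_ex.
  + exact: d_ex.
(* Only for [l = 0] is the leftmost morphism the new composite [f \oc d 0]. *)
- by case: l Qd {d_ex SC} => [|l] //= Qd; apply/Qs.
- by case=> [|j] // lt_jl; apply: SC.
Qed.

Lemma resolved_uncons Q S a l :
  spliceable Q -> resolved Q S a l.+1 ->
  exists k p (f : Hom k p) (g : Hom p a),
    [/\ short_exact f g, S p & resolved Q S k l].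
Proof.
move=> Qs [C [d [<- [d0_e d_ex] Qd SC]]].
(* [k] is the image of [d 1], which is also the kernel of [d 0]. *)
have /(exactP abA) [k [e [m [dE e_epi m_ker]]]] := d_ex 0 isT.
have m_m := kernel_mono m_ker.
exists k, (C 1), m, (d 0); split; [exact/(short_exactP abA)|exact: SC|].
pose C' j := if j is i.+1 then C i.+2 else k.
pose d' j : Hom (C' j.+1) (C' j) :=
  match j return Hom (C' j.+1) (C' j) with 0 => e | i.+1 => d i.+2 end.
exists C', d'; split=> //.
- split=> // -[|j] lt_jl; last exact: d_ex.
  by apply/(exact_mono_compl abA _ _ m_m); rewrite -dE; apply: d_ex.
- by case: l Qd {d_ex SC} => [|l] //=; rewrite dE => /Qs; apply.
- by move=> j le_jl; apply: SC.
Qed.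

Lemma resolved0 Q S a :
  resolved Q S a 0 <-> exists p (g : Hom p a), [/\ is_epi g, Q _ _ g & S p].
Proof.
split=> [[C [d [<- [d_e _] Qd SC]]]|[p [g [g_e Qg Sp]]]].
  by exists (C 1), (d 0); split=> //; apply: SC.
pose C j := if j is 0 then a else p.
pose d j : Hom (C j.+1) (C j) :=
  match j return Hom (C j.+1) (C j) with 0 => g | _.+1 => idm p end.
by exists C, d; split=> // -[].
Qed.

End Splicing.

Lemma kernels_closedP {A : preadditive} (abA : abelian_category A) m (S : subcat A) :
  kernels_closed m S <->
  forall a, @resolved (op A) (fun _ _ _ => True) S a m -> S a.
Proof.
split=> [clS a [C [d [<- [d0_m d_ex] _ SC]]]|clS C d [d0_m d_ex] SC].
  by apply: (clS C d) => //; split=> // j lt_jm; apply/(exact_opE abA)/d_ex.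
apply: clS; exists C, d; split=> //; split=> // j lt_jm.
exact/(exact_opE abA)/d_ex.
Qed.

(** * The equivalences for the left class *)

Section LeftClass.
Context {A : preadditive} (abA : abelian_category A).
Context (projA : enough_projectives A) (injA : enough_injectives A).
(** The assumptions are phrased with [ext1_zero] and cosyzygies so that they can be met both by [X],
    [Y] in [A] and by [Y], [X] in [op A]. *)
Context {X : subcat A} {Y : A -> Prop}.
Context (XP : forall a, X a <-> forall y, Y y -> ext1_zero a y).
Context (Ycosyz : forall y i z (f : Hom y i) (g : Hom i z),
  short_exact f g -> injective_object i -> Y y -> Y z).
Implicit Types a b c z : A.

Fixpoint cosyzygy j z : Prop :=
  if j is i.+1 then exists y e (f : Hom y e) (g : Hom e z),
    [/\ short_exact f g, injective_object e & cosyzygy i y]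
  else Y z.

Lemma cosyzygyS j z : cosyzygy j.+1 z -> cosyzygy j z.
Proof.
elim: j z => [|j IHj] z [y [e [f [g [fg e_inj cy]]]]]; first exact: Ycosyz fg e_inj cy.
by exists y, e, f, g; split=> //; apply: IHj.
Qed.

Lemma cosyzygy_le i j z : i <= j -> cosyzygy j z -> cosyzygy i z.
Proof.
by move=> /subnK <-; elim: (j - i) => // k IHk; rewrite addSn => /cosyzygyS.
Qed.

Definition perp j a := forall z, cosyzygy j z -> ext1_zero a z.

Lemma perp_le i j a : i <= j -> perp i a -> perp j a.
Proof. by move=> le_ij a_i z /(cosyzygy_le le_ij); apply: a_i. Qed.

Lemma perp_iso j a b (f : Hom a b) : is_iso f -> perp j a -> perp j b.
Proof. by move=> f_iso a_j z /a_j; apply: ext1_iso f_iso. Qed.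

Definition perp_sub j : subcat A := Subcat (@perp_iso j).

Lemma perp_extension j : extension_closed (perp_sub j).
Proof.
move=> a b c f g fg a_j c_j z zj.
exact: (ext1_extension abA injA fg (a_j z zj) (c_j z zj)).
Qed.

Lemma perp0 a : perp 0 a <-> X a.
Proof. exact: iff_sym (XP a). Qed.

(** Let [w] be the cokernel of [z] in an injective [e]. A map from [a] to [w] extends to [b] since
    [w] is a cosyzygy of index [j.+1], then lifts to [e]; restricting to [a] gives the required
    lift. *)
Lemma perp_left j a b c (f : Hom a b) (g : Hom b c) :
  short_exact f g -> perp j b -> perp j.+1 c -> perp j a.
Proof.
move=> fg b_j c_j z zj; have [e [m [e_inj m_m]]] := injA z.
have [w [q mq]] := mono_short_exact abA m_m.
apply: (ext1_of_copresentation abA mq) => [|h]; first exact: injective_ext1.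
have [|t1 <-] := ext1_extend abA h (c_j w _) fg; first by exists z, e, m, q.
have [t2 <-] := ext1_lift abA t1 (b_j z zj) mq.
by exists (t2 \oc f); rewrite compA.
Qed.

(** Write [w] as the cokernel of [z] in an injective [e]. A map from [a] to [w] lifts to [e],
    extends to [b] by injectivity, and is pushed back to [w]. *)
Lemma perp_right j a b c (f : Hom a b) (g : Hom b c) :
  short_exact f g -> perp j a -> perp j.+1 b -> perp j.+1 c.
Proof.
move=> fg a_j b_j w wj; have [z [e [m [q [mq e_inj zj]]]]] := wj.
apply: (ext1_of_presentation abA fg) => [|h]; first exact: b_j.
have [t1 <-] := ext1_lift abA h (a_j z zj) mq.
have [|t2 <-] := e_inj _ _ f t1; first by case: fg.
by exists (q \oc t2); rewrite -compA.
Qed.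

Lemma perp_resolution l a : has_resolution X a l -> perp l a.
Proof.
elim: l a => [|l IHl] a.
  move=> /resolved0 [p [g [g_e g_m Xp]]]; apply/perp0.
  exact: sub_iso (mono_epi_iso abA g_m g_e) Xp.
move=> /(resolved_uncons abA (spliceable_mono (A := A))) [k [p [f [g [fg Xp kl]]]]].
apply: perp_right fg (IHl k kl) _.
by apply: (@perp_le 0) => //; apply/perp0.
Qed.

Lemma projective_left p : projective p -> X p.
Proof. by move=> p_proj; apply/XP => y _; apply: projective_ext1. Qed.

Lemma torsion_free_of_resdim n :
  (forall a, exists2 l, l <= n & has_resolution X a l) ->
  nfold_torsion_free_class n X.
Proof.
move=> res; exists (fun i => perp_sub (n - i)); split=> [a|a|i lt_in].
- have [l le_ln al] := res a; rewrite subn0.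
  exact: perp_le le_ln (perp_resolution al).
- by rewrite subnn; apply: perp0.
(* The ambient class becomes a [perp] of successor index, which is what [perp_left] asks of the
   third term. *)
- have -> : n - i = (n - i.+1).+1 by rewrite subnS prednK // subn_gt0.
  split; first exact: perp_extension.
  + by move=> a; apply: perp_le.
  + by move=> a b c f g [fg _ _ _]; apply: perp_extension fg.
  + by move=> a b c f g [fg _ _ c_i] b_i; apply: perp_left fg b_i c_i.
Qed.

Lemma perp_cokernels m a :
  (forall c, perp m.+1 c) -> @resolved (op A) (fun _ _ _ => True) X a m -> X a.
Proof.
move=> perpA a_m; apply/perp0.
(* The goal is generalized from [perp 0] to [perp i]: passing to a cokernel raises [i] and lowers
   [m] by one, so [m.+1 + i] is constant and the last cokernel is in [perp i.+1]. *)
have {perpA}: forall c, perp (m.+1 + 0) c by rewrite addn0.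
elim: m 0 a a_m => [|m IHm] i a.
  move=> /resolved0 [p [g [g_m _ Xp]]] perpA.
  have [c [q gq]] := mono_short_exact abA (f := (g : Hom a p)) g_m.
  by apply: perp_left gq _ (perpA c); apply: perp_le (leq0n _) _; apply/perp0.
move=> /(resolved_uncons (abelian_op abA)) [//|k [p [f [g [fg Xp km]]]]].
rewrite addSnnS => perpA; apply: perp_left (IHm i.+1 k km perpA).
  by move/(short_exact_opE abA): fg; apply.
by apply: perp_le (leq0n _) _; apply/perp0.
Qed.

Lemma KE_closed_of_resdim m :
  (forall a, exists2 l, l <= m.+1 & has_resolution X a l) -> KE_closed m X.
Proof.
move=> res; split.
  by move=> a b c f g fg /perp0 a0 /perp0 c0; apply/perp0; apply: perp_extension fg a0 c0.
apply/(kernels_closedP abA) => a; apply: perp_cokernels => c.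
have [l le_lm cl] := res c; exact: perp_le le_lm (perp_resolution cl).
Qed.

(** * Syzygies and upper bounds on resolution dimensions *)

Inductive syzygy a : nat -> A -> Prop :=
| syzygy_refl : syzygy a 0 a
| syzygy_step i k p w (f : Hom k p) (g : Hom p w) :
    short_exact f g -> projective p -> syzygy a i w -> syzygy a i.+1 k.

Lemma exists_syzygy a i : exists k, syzygy a i k.
Proof.
elim: i => [|i [w aw]]; first by exists a; constructor.
have [k [p [f [g [p_proj fg]]]]] := exists_presentation abA projA w.
by exists k; apply: syzygy_step fg p_proj aw.
Qed.

Lemma syzygy_resolution a i k l :
  syzygy a i k -> has_resolution X k l -> has_resolution X a (i + l).
Proof.
move=> ak; elim: ak l => {i k} // i k p w f g fg p_proj aw IHw l kl.
rewrite addSnnS; apply: IHw; apply: (resolved_cons abA _ fg) kl.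
  exact: spliceable_mono.
exact: projective_left.
Qed.

Lemma resdim_of_syzygies n :
  (forall a k, syzygy a n k -> X k) ->
  forall a, exists2 l, l <= n & has_resolution X a l.
Proof.
move=> nX a; exists n => //; have [k ak] := exists_syzygy a n.
rewrite -[n]addn0; apply: (syzygy_resolution ak); apply/resolved0.
exists k, (idm k); split; last exact: nX ak.
- by move=> x u v; rewrite !compm1.
- by move=> x u v; rewrite !comp1m.
Qed.

Lemma resdim_of_torsion_free n :
  nfold_torsion_free_class n X ->
  forall a, exists2 l, l <= n & has_resolution X a l.
Proof.
move=> [F [F0 Fn tf]]; apply: resdim_of_syzygies => a k ak; apply/Fn.
have XF i x : i <= n -> X x -> F i x.
  move=> /subnKC; move: (n - i) => j; elim: j i => [|j IHj] i.
    by rewrite addn0 => -> /Fn.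
  move=> ijn Xx; apply: (tf_sub (tf i _)); first by rewrite -ijn addnS ltnS leq_addr.
  by apply: IHj => //; rewrite addSnnS.
(* The claim covers all [j >= i], not just [j = i]: to deduce that a syzygy [x] is in [F i.+1] from
   its presentation, [x] itself must already be in [F i] for the presentation to be a conflation. *)
suff FS i j x : i <= j -> i <= n -> syzygy a j x -> F i x by exact: (FS n n).
elim: i j x => [|i IHi] j x // lt_ij lt_in ax.
case: ax lt_ij => // {}j {}x p w f g fg p_proj aw lt_ij.
have Xp := projective_left p_proj.
apply: (tf_left (tf i lt_in) (f := f) (g := g)); last exact: XF.
split=> //.
- apply: IHi (leqW lt_ij) (ltnW lt_in) _; exact: syzygy_step fg p_proj aw.
- by apply: XF Xp; apply: ltnW.
- exact: IHi lt_ij (ltnW lt_in) aw.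
Qed.

(** The syzygy of index [m.+1] is the start of an exact sequence through [m.+1] projectives, which
    are in [X]; it is thus an [m]-kernel. *)
Lemma resdim_of_KE_closed m :
  KE_closed m X -> forall a, exists2 l, l <= m.+1 & has_resolution X a l.
Proof.
move=> [_ /(kernels_closedP abA) clX]; apply: resdim_of_syzygies => a k ak.
(* The index is abstracted with an equation so that induction on the syzygy can lower [m]. *)
apply: clX; move: {-2}m.+1 ak (erefl m.+1) => j ak.
elim: ak m => {j k} // i k p w f g fg p_proj aw IHw m [im].
have Xp := projective_left p_proj.
case: m im => [|m] im.
  by case: fg => f_m _ _; apply/resolved0; exists p, f.
apply: (resolved_cons (abelian_op abA) _ _ Xp (IHw m im)) => //.
exact/(short_exact_opE abA)/fg.
Qed.

Lemma left_class_equivalence n : 0 < n ->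
  [<-> nfold_torsion_free_class n X;
       KE_closed n.-1 X;
       enat_le (global_resdim X) (Some n)].
Proof.
case: n => // m _; tfae.
- by move/resdim_of_torsion_free/KE_closed_of_resdim.
- by move/resdim_of_KE_closed/global_resdimP.
- by move/global_resdimP/torsion_free_of_resdim.
Qed.

End LeftClass.

(** * Passage to the opposite category *)

Section Opposite.
Context {A : preadditive}.

Definition op_sub (S : subcat A) : subcat (op A).
Proof.
apply: (@Subcat (op A) (fun a : A => S a)) => a b f [g [gf fg]] Sa.
by apply: (@sub_iso A S a b g _ Sa); exists f.
Defined.

(** Applying [op_sub] over [op A] would instead give a subcategory of [op (op A)]. *)
Definition unop_sub (S : subcat (op A)) : subcat A.
Proof.
apply: (@Subcat A (fun a : op A => S a)) => a b f [g [gf fg]] Sa.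
by apply: (@sub_iso (op A) S a b g _ Sa); exists f.
Defined.

Context (abA : abelian_category A).

Lemma extension_closed_op (S : subcat A) :
  extension_closed (op_sub S) <-> extension_closed S.
Proof.
split=> clS a b c f g fg Sa Sc.
  by apply: (clS c b a g f) Sc Sa; apply/(short_exact_opE abA).
by move/(short_exact_opE abA): fg => fg; apply: clS fg Sc Sa.
Qed.

Lemma torsion_class_op (E S : subcat A) :
  torsion_free_class (op_sub E) (op_sub S) <-> torsion_class E S.
Proof.
split=> -[clE sub ext side].
- split=> //; first exact/extension_closed_op.
  + move=> a b c f g [fg Ea Eb Ec] Sa Sc; apply: (ext c b a g f) Sc Sa.
    by split=> //; apply/(short_exact_opE abA).
  + move=> a b c f g [fg Ea Eb Ec]; apply: (side c b a g f).
    by split=> //; apply/(short_exact_opE abA).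
- split=> //; first exact/extension_closed_op.
  + move=> a b c f g [/(short_exact_opE abA) fg Ea Eb Ec] Sa Sc.
    exact: ext (And4 fg Ec Eb Ea) Sc Sa.
  + move=> a b c f g [/(short_exact_opE abA) fg Ea Eb Ec].
    exact: side (And4 fg Ec Eb Ea).
Qed.

Lemma nfold_torsion_class_op n (S : subcat A) :
  nfold_torsion_free_class n (op_sub S) <-> nfold_torsion_class n S.
Proof.
split=> -[F [F0 Fn tF]].
- exists (fun i => unop_sub (F i)); split=> // i lt_in.
  (* [op_sub (unop_sub (F i))] has the members of [F i] but another proof of [sub_iso], so the
     record is rebuilt field by field. *)
  by apply/torsion_class_op; case: (tF i lt_in) => *; split.
- exists (fun i => op_sub (F i)); split=> // i lt_in.
  exact/torsion_class_op/tF.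
Qed.

Lemma right_exact_sequence_op m (C : nat -> A) (d : forall j, Hom (C j) (C j.+1)) :
  @right_exact_sequence (op A) m C d <-> left_exact_sequence m d.
Proof.
by split=> -[d0_m d_ex]; split=> // j lt_jm; apply/(exact_opE abA)/d_ex.
Qed.

Lemma left_exact_sequence_op m (C : nat -> A) (d : forall j, Hom (C j.+1) (C j)) :
  @left_exact_sequence (op A) m C d <-> right_exact_sequence m d.
Proof.
by split=> -[d0_e d_ex]; split=> // j lt_jm; apply/(exact_opE abA)/d_ex.
Qed.

Lemma CE_closed_op m (S : subcat A) : KE_closed m (op_sub S) <-> CE_closed m S.
Proof.
split=> -[/extension_closed_op clS ker]; split=> // C d.
- by move=> /left_exact_sequence_op; apply: ker.
- by move=> /left_exact_sequence_op; apply: ker.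
Qed.

Lemma has_coresolution_op (S : subcat A) a l :
  has_resolution (op_sub S) a l <-> has_coresolution S a l.
Proof.
by split=> -[C [d [C0 /right_exact_sequence_op Cd dl SC]]]; exists C, d; split=> //;
  apply/right_exact_sequence_op.
Qed.

End Opposite.

Theorem theorem1p4 (A : preadditive) (abA : abelian_category A)
    (projA : enough_projectives A) (injA : enough_injectives A)
    (X Y : subcat A) (cotXY : cotorsion_pair X Y) (herXY : hereditary X Y)
    (n : nat) (n_gt0 : 0 < n) :
  [<-> nfold_torsion_free_class n X;
       KE_closed n.-1 X;
       enat_le (global_resdim X) (Some n)] /\
  [<-> nfold_torsion_class n Y;
       CE_closed n.-1 Y;
       enat_le (global_coresdim Y) (Some n)].
Proof.
have [cotX cotY] := cotXY.
have XP a : X a <-> forall y, Y y -> ext1_zero a y.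
  by rewrite (cotX a); split=> aY y Yy; apply/(Ext1P abA projA)/aY.
have YP b : Y b <-> forall x, X x -> ext1_zero x b.
  by rewrite (cotY b); split=> bX x Xx; apply/(Ext1P abA projA)/bX.
(* Heredity enters here, in degree 2, through the shift from [x] to its syzygy [k]. *)
have Xsyz k p x (f : Hom k p) (g : Hom p x) :
    short_exact f g -> projective p -> X x -> X k.
  move=> fg p_proj Xx; apply/cotX => y Yy.
  exact: (Ext_eq0_syzygy abA p_proj fg (herXY 2 x y isT Xx Yy)).
(* Deduced from [Xsyz], since Ext is computed by projective resolutions: for a syzygy [k] of [x] in
   [X], a map from [k] to [z] lifts to [i], then extends to [p] by injectivity. *)
have Ycosyz y i z (f : Hom y i) (g : Hom i z) :
    short_exact f g -> injective_object i -> Y y -> Y z.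
  move=> fg i_inj Yy; apply/YP => x Xx.
  have [k [p [m [q [p_proj mq]]]]] := exists_presentation abA projA x.
  apply: (ext1_of_presentation abA mq) => [|h]; first exact: projective_ext1.
  have /XP kY := Xsyz _ _ _ _ _ mq p_proj Xx.
  have [t1 <-] := ext1_lift abA h (kY y Yy) fg.
  have [|t2 <-] := i_inj _ _ m t1; first by case: mq.
  by exists (g \oc t2); rewrite -compA.
split.
  exact: (left_class_equivalence abA projA injA XP Ycosyz).
(* In [op A] the roles are exchanged: [Y] is the left class, and closure of [X] under syzygies
   becomes closure under cosyzygies. *)
have YPop b : op_sub Y b <-> forall x, X x -> @ext1_zero (op A) b x.
  by rewrite (YP b); split=> bX x Xx; apply/(ext1_zero_opE abA)/bX.
have Xcosyz y i z (f : @Hom (op A) y i) (g : @Hom (op A) i z) :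
    short_exact f g -> injective_object i -> X y -> X z.
  move=> /(short_exact_opE abA) fg i_inj.
  exact: (Xsyz _ _ _ _ _ fg (fun b c => i_inj c b)).
have projO : enough_projectives (op A).
  move=> a; have [i [m [i_inj m_m]]] := injA a.
  by exists i, m; split=> // b c; apply: i_inj.
have injO : enough_injectives (op A).
  move=> a; have [p [e [p_proj e_e]]] := projA a.
  by exists p, e; split=> // b c; apply: p_proj.
have eqv := left_class_equivalence (abelian_op abA) projO injO YPop Xcosyz n_gt0.
have dimY : enat_le (global_coresdim Y) (Some n) <->
    enat_le (global_resdim (op_sub Y)) (Some n).
  rewrite global_coresdimP global_resdimP.
  by split=> dimY a; have [l le_ln al] := dimY a; exists l => //;
    apply/(has_coresolution_op abA).
tfae.
- by move=> /(nfold_torsion_class_op abA) /(eqv 0 1) /(CE_closed_op abA).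
- by move=> /(CE_closed_op abA) /(eqv 1 2) /dimY.
- by move=> /dimY /(eqv 2 0) /(nfold_torsion_class_op abA).
Qed.
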